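(* For a frame $L$, the following are equivalent. \begin{enumerate} \item $L$ is subfit. \item All exact filters of $L$ are regular. \item $(L,\mathsf{Filt}_{\mathcal{E}}(L)^{op})$ is a $T_1$ Raney extension. \item There exists a $T_1$ Raney extension $(L,C)$. \item There is a unique $T_1$ Raney extension on $L$, up to isomorphism. This is $(L,\mathsf{Filt}_{\mathcal{R}}(L)^{op})$. \end{enumerate}
   Context: A frame $L$ is subfit if whenever $x\not\le y$ in $L$ there is $u\in L$ with $x\vee u=1$ and $y\vee u\neq 1$. A Raney extension is a pair $(L,C)$ where $C$ is a coframe, $L\subseteq C$ is a frame such that every element of $C$ is a meet of elements of $L$, and the inclusion preserves arbitrary joins, finite meets, and strongly exact meets of $L$ (a meet $\bigwedge_i x_i$ in $L$ is strongly exact if for all $y\in L$, $x_i\to y=y$ for all $i$ implies $(\bigwedge_i x_i)\to y=y$). It is $T_1$ if $C$ is a Boolean algebra. A morphism $f:(L,C)\to(M,D)$ is a coframe map $f:C\to D$ (preserving arbitrary meets and finite joins) with $f[L]\subseteq M$ restricting to a frame map $L\to M$; isomorphisms are taken in this category. $\mathsf{Filt}(L)$ is the frame of all filters of $L$ (including the improper one) ordered by inclusion. A meet $\bigwedge_i x_i$ in $L$ is exact if $(\bigwedge_i x_i)\vee a=\bigwedge_i(x_i\vee a)$ for all $a\in L$; a filter is exact if closed under exact meets. A filter is regular if it is of the form $F\to\{1\}$ in the frame $\mathsf{Filt}(L)$; equivalently, an intersection of filters of the form $\{x\in L:x\vee a=1\}$, $a\in L$. $\mathsf{Filt}_{\mathcal{E}}(L)$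 and $\mathsf{Filt}_{\mathcal{R}}(L)$ are the collections of exact and of regular filters, ordered by inclusion. In pairs $(L,\mathcal{F}^{op})$ with $\mathcal{F}$ a collection of filters, $a\in L$ is identified with the principal filter $\uparrow a$. $(L,\mathsf{Filt}_{\mathcal{E}}(L)^{op})$ is always a Raney extension; item (5) includes the assertion that $(L,\mathsf{Filt}_{\mathcal{R}}(L)^{op})$ is a Raney extension. *)

(* Defs.v *)
From HB Require Import structures.
From mathcomp Require Import all_boot all_order.
From mathcomp Require Import boolp classical_sets.

Set Implicit Arguments.
Unset Strict Implicit.
Unset Printing Implicit Defensive.

Import Order.TTheory.

Local Open Scope classical_set_scope.
Local Open Scope order_scope.

HB.mixin Record TBLattice_isComplete d T of Order.TBLattice d T := {
  Join : set T -> T;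
  Meet : set T -> T;
  Join_supremum : forall A, supremums A (Join A);
  Meet_infimum : forall A, infimums A (Meet A)
}.

#[short(type="completeLatticeType")]
HB.structure Definition CompleteLattice d :=
  { T of Order.TBLattice d T & TBLattice_isComplete d T }.

HB.mixin Record CompleteLattice_isFrame d T of CompleteLattice d T := {
  meet_Join : forall (x : T) (A : set T),
    x `&` Join A = Join [set x `&` a | a in A]
}.

#[short(type="frameType")]
HB.structure Definition Frame d :=
  { T of CompleteLattice d T & CompleteLattice_isFrame d T }.

HB.factory Record POrder_hasMeets d T of Order.POrder d T := {
  Meet : set T -> T;
  Meet_infimum : forall A, infimums A (Meet A)
}.

HB.builders Context d T of POrder_hasMeets d T.

Let Join (A : set T) : T := Meet (ubound A).

Let le_Meet (A : set T) x : lbound A x -> x <= Meet A.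
Proof. by case: (Meet_infimum A) => _; apply. Qed.

Let Meet_le (A : set T) x : A x -> Meet A <= x.
Proof. by case: (Meet_infimum A) => + _; apply. Qed.

Let Join_supremum (A : set T) : supremums A (Join A).
Proof.
split=> [x Ax|y ubAy]; last exact: Meet_le.
by apply: le_Meet => y; apply.
Qed.

Let meet2P (x y z : T) :
  (x <= Meet [set y; z]) = (x <= y) && (x <= z).
Proof.
apply/idP/andP => [le_x|[le_xy le_xz]].
  by split; apply: le_trans le_x (Meet_le _); [left|right].
by apply: le_Meet => t [->|->].
Qed.

Let join2P (x y z : T) :
  (Join [set x; y] <= z) = (x <= z) && (y <= z).
Proof.
have [ubJ leJ] := Join_supremum [set x; y].
apply/idP/andP => [le_z|[le_xz le_yz]].
  by split; apply: le_trans le_z; apply: ubJ; [left|right].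
by apply: leJ => t [->|->].
Qed.

Let le0x (x : T) : Join set0 <= x.
Proof. by case: (Join_supremum set0) => _; apply. Qed.

Let lex1 (x : T) : x <= Meet set0.
Proof. exact: le_Meet. Qed.

HB.instance Definition _ :=
  Order.POrder_MeetJoin_isLattice.Build d T meet2P join2P.
HB.instance Definition _ := Order.hasBottom.Build d T le0x.
HB.instance Definition _ := Order.hasTop.Build d T lex1.
HB.instance Definition _ :=
  TBLattice_isComplete.Build d T Join_supremum Meet_infimum.

HB.end.

HB.instance Definition _ d (T : completeLatticeType d) :=
  TBLattice_isComplete.Build _ T^d
    (@Meet_infimum d T) (@Join_supremum d T).

Section CompleteLatticeTheory.
Context d (T : completeLatticeType d).
Implicit Types (A : set T) (x y : T).

Lemma Join_ub A x : A x -> x <= Join A.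
Proof. by case: (Join_supremum A) => + _; apply. Qed.

Lemma Join_le A y : ubound A y -> Join A <= y.
Proof. by case: (Join_supremum A) => _; apply. Qed.

Lemma Meet_lb A x : A x -> Meet A <= x.
Proof. by case: (Meet_infimum A) => + _; apply. Qed.

Lemma Meet_ge A y : lbound A y -> y <= Meet A.
Proof. by case: (Meet_infimum A) => _; apply. Qed.

End CompleteLatticeTheory.

Definition himp d (L : frameType d) (x y : L) : L :=
  Join [set z | z `&` x <= y].

Section FrameTheory.
Context d (L : frameType d).
Implicit Types (x y z : L).

Lemma le_himp x y z : (z <= himp x y) = (z `&` x <= y).
Proof.
apply/idP/idP => [le_z|]; last exact: Join_ub.
apply: (le_trans (leI2 le_z (lexx x))).
rewrite meetC meet_Join; apply: Join_le => _ [t /= le_t <-].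
by rewrite meetC.
Qed.

Lemma frame_meetUr x y z : x `&` (y `|` z) = (x `&` y) `|` (x `&` z).
Proof.
apply/eqP; rewrite eq_le; apply/andP; split.
  by rewrite meetC -le_himp leUx !le_himp ![_ `&` x]meetC leUl leUr.
by rewrite leUx !leI2 ?leUl ?leUr ?lexx.
Qed.

Lemma frame_joinIr x y z : x `|` (y `&` z) = (x `|` y) `&` (x `|` z).
Proof.
rewrite frame_meetUr [_ `&` x]meetC joinKI [(_ `|` _) `&` z]meetC frame_meetUr.
by rewrite joinA meetKUC [z `&` y]meetC.
Qed.

End FrameTheory.

Definition subfit d (L : frameType d) : Prop :=
  forall x y : L, ~~ (x <= y) ->
    exists u : L, x `|` u = \top /\ y `|` u <> \top.

Definition coframe d (C : completeLatticeType d) : Prop :=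
  forall (x : C) (A : set C), x `|` Meet A = Meet [set x `|` a | a in A].

Definition boolean_algebra d (C : tbLatticeType d) : Prop :=
  (forall x y z : C, x `&` (y `|` z) = (x `&` y) `|` (x `&` z)) /\
  (forall x : C, exists y : C, x `&` y = \bot /\ x `|` y = \top).

Definition exact_meet d (L : frameType d) (A : set L) : Prop :=
  forall a : L, Meet A `|` a = Meet [set x `|` a | x in A].

Definition strongly_exact_meet d (L : frameType d) (A : set L) : Prop :=
  forall y : L, (forall x, A x -> himp x y = y) -> himp (Meet A) y = y.

(* A pair (L, C) with L included in C is given by an order embedding
   e : L -> C, so that L carries the order of C. *)
Record raney_extension d (L : frameType d) d' (C : completeLatticeType d')
    (e : L -> C) : Prop := RaneyExtension {
  raney_coframe : coframe C;
  raney_embedding : {mono e : x y / x <= y};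
  raney_dense : forall c : C, exists A : set L, c = Meet (e @` A);
  raney_Join : forall A : set L, e (Join A) = Join (e @` A);
  raney_top : e \top = \top;
  raney_meet : forall x y : L, e (x `&` y) = e x `&` e y;
  raney_strongly_exact : forall A : set L,
    strongly_exact_meet A -> e (Meet A) = Meet (e @` A)
}.

Definition T1_raney_extension d (L : frameType d) d'
    (C : completeLatticeType d') (e : L -> C) : Prop :=
  raney_extension e /\ boolean_algebra C.

Record frame_map d (L : frameType d) d' (M : frameType d') (g : L -> M) :
    Prop := FrameMap {
  frame_map_Join : forall A : set L, g (Join A) = Join (g @` A);
  frame_map_top : g \top = \top;
  frame_map_meet : forall x y : L, g (x `&` y) = g x `&` g y
}.

Record coframe_map d (C : completeLatticeType d) d'
    (D : completeLatticeType d') (f : C -> D) : Prop := CoframeMap {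
  coframe_map_Meet : forall A : set C, f (Meet A) = Meet (f @` A);
  coframe_map_bot : f \bot = \bot;
  coframe_map_join : forall x y : C, f (x `|` y) = f x `|` f y
}.

Definition raney_morphism dL (L : frameType dL) dC (C : completeLatticeType dC)
    dM (M : frameType dM) dD (D : completeLatticeType dD)
    (e : L -> C) (e' : M -> D) (f : C -> D) : Prop :=
  coframe_map f /\
  exists g : L -> M, frame_map g /\ forall x : L, f (e x) = e' (g x).

Definition raney_isomorphic dL (L : frameType dL) dC
    (C : completeLatticeType dC) dM (M : frameType dM) dD
    (D : completeLatticeType dD) (e : L -> C) (e' : M -> D) : Prop :=
  exists (f : C -> D) (f' : D -> C),
    [/\ raney_morphism e e' f, raney_morphism e' e f',
        cancel f f' & cancel f' f].

(* The empty intersection is included, so the full set is a member. *)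
Record mooreFamily (T : Type) := MooreFamily {
  moore_sets :> set (set T);
  moore_bigcap : forall S : set (set T), S `<=` moore_sets ->
    moore_sets (\bigcap_(F in S) F)
}.

Definition moore_type (T : Type) (M : mooreFamily T) : Type := set_type M.

Section MooreLattice.
Context (T : Type) (M : mooreFamily T).

HB.instance Definition _ := SubChoice.on (moore_type M).
HB.instance Definition _ :=
  [SubChoice_isSubPOrder of moore_type M by <: with set_display].

Definition moore_elt (F : set T) (MF : moore_sets M F) : moore_type M :=
  exist _ F (mem_set MF).

Lemma moore_valP (F : moore_type M) : moore_sets M (val F).
Proof. exact/set_mem/(valP F). Qed.

Lemma moore_leP (F G : moore_type M) : (F <= G) <-> val F `<=` val G.
Proof. by rewrite -[F <= G]/(val F <= val G) -subsetEset. Qed.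

Lemma moore_image_sub (A : set (moore_type M)) : val @` A `<=` M.
Proof. by move=> _ [F _ <-]; apply: moore_valP. Qed.

Definition moore_Meet (A : set (moore_type M)) : moore_type M :=
  moore_elt (moore_bigcap (@moore_image_sub A)).

Lemma moore_Meet_infimum (A : set (moore_type M)) : infimums A (moore_Meet A).
Proof.
split=> [F AF|G lbAG].
  by apply/moore_leP => x; apply; exists F.
by apply/moore_leP => x Gx _ [F AF <-]; apply: (moore_leP _ _).1 Gx; apply: lbAG.
Qed.

HB.instance Definition _ :=
  POrder_hasMeets.Build set_display (moore_type M) moore_Meet_infimum.

Lemma moore_meetE (F G : moore_type M) (x : T) :
  val (F `&` G) x <-> val F x /\ val G x.
Proof.
split=> [FGx|[Fx Gx]]; first by split; apply: FGx; [exists F|exists G] => //; [left|right].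
by move=> _ [H [->|->] <-].
Qed.

End MooreLattice.

Definition is_filter d (L : frameType d) (F : set L) : Prop :=
  [/\ F \top, forall x y, F x -> x <= y -> F y
    & forall x y, F x -> F y -> F (x `&` y)].

Definition principal d (L : frameType d) (a : L) : set L := [set x | a <= x].

Section Filters.
Context d (L : frameType d).

Lemma filters_bigcap (S : set (set L)) :
  S `<=` [set F | is_filter F] -> is_filter (\bigcap_(F in S) F).
Proof.
move=> Sfilt; split=> [F /Sfilt[]//|x y Sx le_xy F SF|x y Sx Sy F SF].
  by have [_ up _] := Sfilt _ SF; apply: up (Sx F SF) le_xy.
by have [_ _ capF] := Sfilt _ SF; apply: capF (Sx F SF) (Sy F SF).
Qed.

Definition filters : mooreFamily L := MooreFamily filters_bigcap.

Definition Filt : Type := moore_type filters.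

HB.instance Definition _ := CompleteLattice.on Filt.

Lemma filt_meet_Join (F : Filt) (A : set Filt) :
  F `&` Join A = Join [set F `&` G | G in A].
Proof.
apply/eqP; rewrite eq_le; apply/andP; split; last first.
  apply: Join_le => _ [G AG <-]; rewrite leI2 ?lexx //; exact: Join_ub.
set H := Join [set _ | _ in _].
have [H1 Hup HI] : is_filter (val H) := moore_valP H.
have [F1 Fup FI] : is_filter (val F) := moore_valP F.
apply/moore_leP => x /moore_meetE[Fx].
have Kfilt : moore_sets filters [set y | val H (x `|` y)].
  split=> [|y z /= Hy le_yz|y z /= Hy Hz]; first by rewrite /= joinx1.
    by apply: Hup Hy _; rewrite leU2 ?lexx.
  by rewrite frame_joinIr; apply: HI.
have le_AK : Join A <= moore_elt Kfilt.
  apply: Join_le => G AG; apply/moore_leP => y Gy /=.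
  have /moore_leP leH : F `&` G <= H by apply: Join_ub; exists G.
  have [_ Gup _] : is_filter (val G) := moore_valP G.
  apply: leH; apply: (moore_meetE F G _).2; split.
    exact: Fup Fx (leUl _ _).
  exact: Gup Gy (leUr _ _).
by move: le_AK => /moore_leP + Ax => /(_ x Ax) /=; rewrite joinxx.
Qed.

HB.instance Definition _ :=
  CompleteLattice_isFrame.Build set_display Filt filt_meet_Join.

Lemma filter1 : moore_sets filters [set \top].
Proof.
by split=> [//|x y /= ->|x y /= -> ->]; rewrite ?meetxx // le1x => /eqP.
Qed.

Definition one_filter : Filt := moore_elt filter1.

Definition is_exact_filter (F : set L) : Prop :=
  is_filter F /\ forall A : set L, exact_meet A -> A `<=` F -> F (Meet A).

Lemma exact_filters_bigcap (S : set (set L)) :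
  S `<=` [set F | is_exact_filter F] -> is_exact_filter (\bigcap_(F in S) F).
Proof.
move=> Sex; split=> [|A exA AS F SF].
  by apply: filters_bigcap => F SF; case: (Sex _ SF).
by have [_ Fex] := Sex _ SF; apply: Fex => // x /AS; apply.
Qed.

Definition exact_filters : mooreFamily L := MooreFamily exact_filters_bigcap.

Definition is_regular_filter (R : set L) : Prop :=
  exists F : Filt, R = val (himp F one_filter).

Lemma regular_filters_bigcap (S : set (set L)) :
  S `<=` [set R | is_regular_filter R] ->
  is_regular_filter (\bigcap_(R in S) R).
Proof.
move=> Sreg; set one := one_filter.
have Sfilt : S `<=` filters by move=> _ /Sreg[F ->]; apply: moore_valP.
pose X : Filt := moore_elt (moore_bigcap Sfilt).
pose A := [set F : Filt | S (val (himp F one))].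
have le_X : X <= himp (Join A) one.
  rewrite le_himp meet_Join; apply: Join_le => _ [F AF <-].
  by rewrite -le_himp; apply/moore_leP => x Xx; apply: Xx.
have ge_X (F : Filt) : A F -> himp (Join A) one <= himp F one.
  move=> AF; rewrite le_himp.
  apply: le_trans (_ : himp (Join A) one `&` Join A <= _).
    by rewrite leI2 ?lexx //; apply: Join_ub.
  by rewrite -le_himp lexx.
exists (Join A); apply/seteqP; split.
  exact: (moore_leP X _).1 le_X.
move=> x Jx R SR; have [F defR] := Sreg _ SR.
have AF : A F by move: SR; rewrite defR.
by rewrite defR; exact: (moore_leP _ _).1 (ge_X F AF) x Jx.
Qed.

Definition regular_filters : mooreFamily L :=
  MooreFamily regular_filters_bigcap.

End Filters.

(* The map a |-> (principal filter of a) from L to M^op; it exists only when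
   the family M contains all principal filters. *)
Definition principal_op d (L : frameType d) (M : mooreFamily L)
    (princM : forall a : L, moore_sets M (principal a)) : L -> (moore_type M)^d :=
  fun a => moore_elt (princM a).

(* Main.v *)
Require Import Defs.
From mathcomp Require Import all_boot all_order.
From mathcomp Require Import boolp classical_sets.

(** For [S] a subset of the frame [L] let [polar S] be the set of the elements
whose join with every member of [S] is [\top]. Polarity is an antitone Galois
connection of [set L] with itself, and its closed sets are exactly the regular
filters ([himp_one_filter], [polar_regular]). This turns every statement about
regular filters into a computation with joins in [L].

- Let [L] be subfit, [F] an exact filter and [x] a member of its double polar.
  Subfitness forces [x] to be the exact meet of the elements [x `|` f] of [F],
  so [x] is in [F], and [F] is regular ([subfit_exact_regular]).
- Conversely polars are closed under exact meets, so once exact filters are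
  regular the two families are equal ([exact_regular_filters]), and the
  principal filters, which are exact, are regular.
- When principal filters are regular, the opposite of the lattice of regular
  filters is a T1 Raney extension ([regular_T1_raney]): it is a coframe because
  regular filters carry a Heyting implication, polars are complements, and
  strongly exact meets are preserved because they are exact.
- In a Boolean coframe [C] the inequality [x <= y] holds iff [y `|` c = \top]
  for a complement [c] of [x]. When [x] and [y] come from [L], writing [c] as a
  meet of elements of [L] shows that, if [x <= y] fails, one of these elements
  separates [x] from [y] as subfitness demands ([T1_raney_subfit]).
- The same use of complements shows that [c |-> [set x | c <= e x]] takes
  regular values; by density of [L] it is an order isomorphism onto the regular
  filters ordered by reverse inclusion, and an order isomorphism of complete
  lattices fixing [L] is an isomorphism of Raney extensions
  ([T1_raney_unique]). *)

Set Implicit Arguments.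
Unset Strict Implicit.
Unset Printing Implicit Defensive.

Import Order.TTheory.

Local Open Scope classical_set_scope.
Local Open Scope order_scope.

(** * Complete lattices and coframes *)

Section CompleteLattices.
Context d (T : completeLatticeType d).
Implicit Types (A : set T) (m x y z : T).

Lemma Meet_eq A m : infimums A m -> Meet A = m.
Proof.
move=> [lbm ubm]; apply/eqP; rewrite eq_le; apply/andP; split.
  by apply: ubm => x; apply: Meet_lb.
exact: Meet_ge.
Qed.

Lemma Join_eq A m : supremums A m -> Join A = m.
Proof.
move=> [ubm lbm]; apply/eqP; rewrite eq_le; apply/andP; split.
  exact: Join_le.
by apply: lbm => x; apply: Join_ub.
Qed.

Lemma Join_pair x y : Join [set x; y] = x `|` y.
Proof.
apply: Join_eq; split=> [z [->|->]|z ubz]; rewrite ?leUl ?leUr //.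
by rewrite leUx !ubz //; [right|left].
Qed.

Lemma Meet_pair x y : Meet [set x; y] = x `&` y.
Proof.
apply: Meet_eq; split=> [z [->|->]|z lbz]; rewrite ?leIl ?leIr //.
by rewrite lexI !lbz //; [right|left].
Qed.

(** Joins distribute over binary meets, as a special case of the coframe law,
and either distributive law of a lattice implies the other. *)
Lemma coframe_distr : coframe T ->
  forall x y z, x `&` (y `|` z) = (x `&` y) `|` (x `&` z).
Proof.
move=> coT.
have joinIr' x y z : x `|` (y `&` z) = (x `|` y) `&` (x `|` z).
  by rewrite -Meet_pair coT image_setU !image_set1 Meet_pair.
move=> x y z; rewrite joinIr' [_ `|` x]joinC meetKU [(_ `&` _) `|` z]joinC.
by rewrite joinIr' meetA [z `|` x]joinC joinKI [z `|` y]joinC.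
Qed.

(** The rule that transports an inequality in a Boolean coframe into an equation
between a join and [\top], where density by meets can be exploited. *)
Lemma compl_le x y z : coframe T ->
  x `&` y = \bot -> x `|` y = \top -> (y <= z) = (x `|` z == \top).
Proof.
move=> coT xy0 xy1; apply/idP/eqP => [le_yz|xz1].
  apply/eqP; rewrite eq_le lex1 /= -xy1; exact: leU2.
rewrite -[y]meetx1 -xz1 coframe_distr // meetC xy0 join0x; exact: leIr.
Qed.

End CompleteLattices.

(** * Order isomorphisms *)

Section OrderIsomorphisms.
Context d (C : completeLatticeType d) d' (D : completeLatticeType d').

Lemma order_iso_coframe_map (f : C -> D) (f' : D -> C) :
  {homo f : x y / x <= y} -> {homo f' : x y / x <= y} ->
  cancel f f' -> cancel f' f -> coframe_map f.
Proof.
move=> fh f'h fK f'K.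
(* An order isomorphism is both a left and a right adjoint of its inverse. *)
have adj c u : (u <= f c) = (f' u <= c).
  by apply/idP/idP => [/f'h|/fh]; rewrite ?fK ?f'K.
have adj' c u : (f c <= u) = (c <= f' u).
  by apply/idP/idP => [/f'h|/fh]; rewrite ?fK ?f'K.
split.
- move=> A; apply/esym/Meet_eq; split=> [_ [a Aa <-]|u lbu].
    by apply/fh/Meet_lb.
  by rewrite adj; apply: Meet_ge => a Aa; rewrite -adj; apply: lbu; exists a.
- by apply/eqP; rewrite eq_le le0x andbT adj' le0x.
- move=> x y; apply/eqP; rewrite eq_le leUx !fh ?leUl ?leUr // !andbT.
  by rewrite adj' leUx -!adj' leUl leUr.
Qed.

End OrderIsomorphisms.

Lemma frame_map_id d (L : frameType d) : frame_map (@id L).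
Proof. by split=> // A; rewrite image_id. Qed.

Lemma raney_isomorphic_of_order_iso d (L : frameType d) dC
    (C : completeLatticeType dC) dD (D : completeLatticeType dD)
    (e : L -> C) (e' : L -> D) (f : C -> D) (f' : D -> C) :
  {homo f : x y / x <= y} -> {homo f' : x y / x <= y} ->
  cancel f f' -> cancel f' f -> (forall x, f (e x) = e' x) ->
  raney_isomorphic e e'.
Proof.
move=> fh f'h fK f'K fe; exists f, f'; split=> //.
  split; first exact: order_iso_coframe_map fh f'h fK f'K.
  by exists id; split=> //; apply: frame_map_id.
split; first exact: order_iso_coframe_map f'h fh f'K fK.
by exists id; split=> [|x]; [apply: frame_map_id|rewrite -fe fK].
Qed.

(** * Elements of a Raney extension *)

Section RaneyExtensions.
Context d (L : frameType d) dC (C : completeLatticeType dC) (e : L -> C).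
Hypothesis Ce : raney_extension e.

Lemma raney_join x y : e (x `|` y) = e x `|` e y.
Proof.
by rewrite -(Join_pair x y) (raney_Join Ce) image_setU !image_set1 Join_pair.
Qed.

Lemma raney_eq_top x : (e x == \top) = (x == \top).
Proof.
by rewrite -(raney_top Ce) (inj_eq (inc_inj (raney_embedding Ce))).
Qed.

(** The coframe law reduces covering by an arbitrary element of [C] to covering
by elements of [L]: every element of [C] is a meet of such. *)
Lemma raney_join_Meet_eq_top c (A : set L) :
  c `|` Meet (e @` A) = \top <-> forall a, A a -> c `|` e a = \top.
Proof.
rewrite (raney_coframe Ce); split=> [AT a Aa|AT].
  apply/eqP; rewrite eq_le lex1 -AT; apply: Meet_lb.
  by exists (e a) => //; exists a.
apply: Meet_eq; split=> [_ [_ [a Aa <-] <-]|u _]; last exact: lex1.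
by rewrite AT.
Qed.

(** The family given by density may be taken to be the largest possible one,
which depends canonically, hence monotonically, on [c]. *)
Lemma raney_Meet_above c : Meet (e @` [set x | c <= e x]) = c.
Proof.
have [A ->] := raney_dense Ce c.
apply: Meet_eq; split=> [_ [x /= cx <-] //|u lbu].
apply: Meet_ge => _ [a Aa <-]; apply: lbu; exists a => //=.
by apply: Meet_lb; exists a.
Qed.

End RaneyExtensions.

(** With [c] a complement of [e x], the failure of [x <= y] says that
[e y `|` c] is not [\top]. As [c] is a meet of elements of [L], some [u] in [L]
above [c] already has [y `|` u <> \top], while [x `|` u = \top] because [u] is
above a complement of [x]. *)
Lemma T1_raney_subfit d (L : frameType d) dC (C : completeLatticeType dC)
    (e : L -> C) : T1_raney_extension e -> subfit L.
Proof.
move=> [Ce [_ compl]] x y.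
have [c [xc0 xc1]] := compl (e x); rewrite -(raney_embedding Ce).
have cx0 : c `&` e x = \bot by rewrite meetC.
have cx1 : c `|` e x = \top by rewrite joinC.
rewrite (compl_le _ (raney_coframe Ce) cx0 cx1) joinC.
rewrite -(raney_Meet_above Ce c) => /eqP.
move=> /(raney_join_Meet_eq_top Ce) /existsNP[u /not_implyP[/= cu yu]].
exists u; split.
  apply/eqP; rewrite -(raney_eq_top Ce) raney_join // eq_le lex1 /= -xc1.
  by rewrite leU2.
by move=> yu1; apply: yu; rewrite -raney_join // yu1 raney_top.
Qed.

(** * Polars, regular filters and exact filters *)

Section Polars.
Context d (L : frameType d).
Implicit Types (S F R A : set L) (x y : L).

Definition polar S : set L := [set x | forall a, S a -> x `|` a = \top].

Lemma sub_polarC S F : S `<=` polar F -> F `<=` polar S.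
Proof. by move=> SF x Fx a Sa; rewrite joinC; apply: SF. Qed.

Lemma sub_polarK S : S `<=` polar (polar S).
Proof. exact: sub_polarC. Qed.

Lemma polar_anti S F : S `<=` F -> polar F `<=` polar S.
Proof. by move=> SF x Fx a /SF; apply: Fx. Qed.

Lemma polarK S : polar (polar (polar S)) = polar S.
Proof.
apply/seteqP; split; last exact: sub_polarK.
exact/polar_anti/sub_polarK.
Qed.

Lemma polar_is_filter S : is_filter (polar S).
Proof.
split=> [a _|x y Sx le_xy a Sa|x y Sx Sy a Sa]; first by rewrite join1x.
  by apply/eqP; rewrite eq_le lex1 -(Sx a Sa) leU2.
by rewrite joinC frame_joinIr ![a `|` _]joinC Sx // Sy // meetx1.
Qed.

(** In [Filt L] the pseudocomplement of [F] is its polar: if [x] is in the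
former and [f] in [F], then [x `|` f] lies in the meet of the two filters. *)
Lemma himp_one_filter (F : Filt L) :
  val (himp F (one_filter L)) = polar (val F).
Proof.
apply/seteqP; split=> [x Fx f Ff|].
  have [_ Fup _] : is_filter (val F) := moore_valP F.
  have [_ Iup _] : is_filter (val (himp F (one_filter L))) :=
    @moore_valP _ (filters L) _.
  have /moore_leP : himp F (one_filter L) `&` F <= one_filter L.
    by rewrite -le_himp.
  apply; apply/moore_meetE; split; first exact: Iup Fx (leUl _ _).
  exact: Fup Ff (leUr _ _).
have polF : moore_sets (filters L) (polar (val F)) by apply: polar_is_filter.
pose P : Filt L := moore_elt polF.
have /moore_leP : P <= himp F (one_filter L); last by apply.
rewrite le_himp; apply/moore_leP.
by move=> x /moore_meetE[/= Fx /Fx]; rewrite joinxx.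
Qed.

Lemma polar_regular S : is_regular_filter (polar S).
Proof.
(* The double polar of [S] is a filter with the same polar as [S]. *)
have ppS : moore_sets (filters L) (polar (polar S)) by apply: polar_is_filter.
by exists (moore_elt ppS); rewrite himp_one_filter /= polarK.
Qed.

Lemma regular_polarK R : is_regular_filter R -> polar (polar R) = R.
Proof. by move=> [F ->]; rewrite himp_one_filter polarK. Qed.

(** An exact meet of elements joining with [a] to [\top] joins with [a] to the
meet of copies of [\top]. *)
Lemma polar_exact_meet S A : exact_meet A -> A `<=` polar S -> polar S (Meet A).
Proof.
move=> exA AS a Sa; rewrite exA.
apply: Meet_eq; split=> [_ [x Ax <-]|u _]; last exact: lex1.
by rewrite AS.
Qed.

Lemma regular_exact R : is_regular_filter R -> is_exact_filter R.
Proof.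
move=> /regular_polarK <-; split; first exact: polar_is_filter.
by move=> A; apply: polar_exact_meet.
Qed.

Lemma principal_exact (a : L) : is_exact_filter (principal a).
Proof.
split; last by move=> A _ Aa; apply: Meet_ge => x /Aa.
split=> [|x y ax|x y ax ay]; rewrite /principal /= ?lex1 ?lexI ?ax //.
exact: le_trans.
Qed.

(** For [x] in the double polar of [F] and any [b], the meet of all
[x `|` f `|` b], with [f] in [F], is [x `|` b]. Otherwise subfitness gives a [u]
covering some lower bound of these elements but not [x `|` b]; then
[x `|` b `|` u] is in the polar of [F], so it joins with [x] to [\top], which
contradicts the choice of [u]. Hence [x] is an exact meet of elements of [F]. *)
Lemma subfit_exact_regular :
  subfit L -> moore_sets (exact_filters L) `<=` moore_sets (regular_filters L).
Proof.
move=> sfL F [[_ Fup _] Fex]; suff -> : F = polar (polar F).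
  exact: polar_regular.
apply/seteqP; split; first exact: sub_polarK.
move=> x xpp; pose A := [set x `|` f | f in F].
have meetA b : Meet [set y `|` b | y in A] = x `|` b.
  apply: Meet_eq; split=> [_ [_ [f Ff <-] <-]|m lbm].
    by rewrite leU2 ?leUl.
  apply: contrapT => /negP /sfL[u [mu xbu]]; apply: xbu.
  suff : x `|` (x `|` b `|` u) = \top by rewrite !joinA joinxx.
  apply: xpp => f Ff; apply/eqP; rewrite eq_le lex1 -mu /= joinAC leU2 //.
  rewrite joinAC; apply: lbm; exists (x `|` f) => //; exists f => //.
have defx : Meet A = x.
  rewrite -[RHS]joinx0 -meetA; congr Meet; apply/seteqP.
  by split=> [y Ay|_ [y Ay <-]]; [exists y; rewrite ?joinx0|rewrite joinx0].
rewrite -defx; apply: Fex => [b|_ [f Ff <-]]; first by rewrite meetA defx.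
exact: Fup Ff (leUr _ _).
Qed.

(** Let [y] be below all the [x `|` a] with [x] in [A]. Since
[y = y `&` (x `|` a)], the element [z = (y -> Meet A `|` a)] does not change
when [y] is replaced with [y `&` x]; that is, [x -> z = z]. Strong exactness
then gives [z = (Meet A -> z) = \top], so that [y <= Meet A `|` a]. *)
Lemma strongly_exact_exact A : strongly_exact_meet A -> exact_meet A.
Proof.
move=> seA a; apply/esym/Meet_eq; split=> [_ [x Ax <-]|y lby].
  by rewrite leU2 // Meet_lb.
pose z := himp y (Meet A `|` a).
suff Az : himp (Meet A) z = z.
  have : \top <= z.
    by rewrite -Az !le_himp meet1x; apply: le_trans (leIl _ _) (leUl _ _).
  by rewrite le_himp meet1x.
apply: seA => x Ax; apply/eqP; rewrite eq_le; apply/andP; split; last first.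
  by rewrite le_himp leIl.
have /meet_idPl yxa : y <= x `|` a by apply: lby; exists x.
have := lexx (himp x z); rewrite le_himp le_himp -meetA => xz.
rewrite le_himp -yxa frame_meetUr frame_meetUr leUx [y `&` x]meetC xz /=.
by rewrite meetA (le_trans (leIr _ _)) ?leUr.
Qed.

End Polars.

(** Equality of the bundled families, and not only of the underlying sets of
filters, lets the T1 property be transported by rewriting. *)
Lemma exact_regular_filters d (L : frameType d) :
  moore_sets (exact_filters L) `<=` moore_sets (regular_filters L) ->
  exact_filters L = regular_filters L.
Proof.
move=> sub.
have : moore_sets (exact_filters L) = moore_sets (regular_filters L).
  by apply/seteqP; split=> // F; apply: regular_exact.
case: (exact_filters L) (regular_filters L) => [M MI] [N NI] /= MN.
by rewrite {sub}MN in MI *; congr MooreFamily; apply: Prop_irrelevance.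
Qed.

(** * The coframe of regular filters *)

Section RegularFilters.
Context d (L : frameType d).
Let Reg := moore_type (regular_filters L).
Implicit Types (F G : Reg) (A : set Reg).

Lemma regular_polarP F : polar (polar (val F)) = val F.
Proof. exact: regular_polarK (@moore_valP _ (regular_filters L) F). Qed.

Lemma regular_filter F : is_filter (val F).
Proof. by rewrite -regular_polarP; apply: polar_is_filter. Qed.

Definition polar_elt (S : set L) : Reg :=
  @moore_elt _ (regular_filters L) (polar S) (polar_regular S).

(** The set of all [x] such that [x `|` y] is in [G] for every [y] in [F],
presented as a polar so that its regularity is immediate. *)
Definition regular_himp F G : Reg :=
  polar_elt [set x | exists y z, [/\ val F y, polar (val G) z & x = y `|` z]].

Lemma le_regular_himp F G H : (H <= regular_himp F G) = (H `&` F <= G).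
Proof.
have [_ Hup _] := regular_filter H; have [_ Fup _] := regular_filter F.
apply/idP/idP => /moore_leP le; apply/moore_leP => x.
  move=> /moore_meetE[/le Hx Fx]; rewrite -regular_polarP => z Gz.
  by rewrite -[x]joinxx -joinA; apply: Hx; exists x, z.
move=> Hx _ [y [z [Fy Gz ->]]]; rewrite joinA joinC; apply: Gz.
apply: le; apply/moore_meetE; split.
  exact: Hup Hx (leUl _ _).
exact: Fup Fy (leUr _ _).
Qed.

Lemma regular_meet_Join F A : F `&` Join A = Join [set F `&` G | G in A].
Proof.
apply/esym/Join_eq; split=> [_ [G AG <-]|H ubH].
  by rewrite leI2 // Join_ub.
rewrite meetC -le_regular_himp; apply: Join_le => G AG.
by rewrite le_regular_himp meetC; apply: ubH; exists G.
Qed.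

(** [F] meets its polar in [\top] only. An element of the polar of a filter
containing [F] and its polar lies in both the polar and the double polar of
[F], so it is [\top]; a regular filter with such a polar is improper. *)
Lemma regular_complement F : exists G, F `|` G = \top /\ F `&` G = \bot.
Proof.
exists (polar_elt (val F)); split; apply/eqP.
all: rewrite eq_le ?lex1 ?le0x ?andbT /=.
  set J := F `|` _.
  have /moore_leP FJ : F <= J := leUl _ _.
  have /moore_leP GJ : polar_elt (val F) <= J := leUr _ _.
  apply/moore_leP => x _; rewrite -regular_polarP => y Jy.
  suff -> : y = \top by rewrite joinx1.
  rewrite -[y]joinxx; have := polar_anti GJ Jy; rewrite regular_polarP => Fy.
  exact: (polar_anti FJ Jy).
apply/moore_leP => x /moore_meetE[Fx /(_ x Fx)]; rewrite joinxx => ->.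
by have [] := regular_filter \bot.
Qed.

Hypothesis princ_reg :
  forall a : L, moore_sets (regular_filters L) (principal a).

Lemma regular_principal_le (a : L) F :
  (moore_elt (princ_reg a) <= F) <-> val F a.
Proof.
have [_ Fup _] := regular_filter F; split=> [/moore_leP|Fa].
  by apply; rewrite /= /principal /=.
by apply/moore_leP => x; apply: Fup.
Qed.

(** The order on the codomain is reverse inclusion: a meet there is a join of
regular filters, so the embedding laws amount to computing the regular filter
generated by a set, which [regular_principal_le] does by testing membership. *)
Lemma regular_raney : raney_extension (principal_op princ_reg).
Proof.
split.
- exact: regular_meet_Join.
- move=> x y; apply/idP/idP.
    move=> /(regular_principal_le y (moore_elt (princ_reg x))) //.
  by move=> xy; apply/(regular_principal_le y (moore_elt (princ_reg x))).
- move=> F; exists (val (F : Reg)); apply/esym/(@Join_eq _ Reg).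
  split=> [_ [x Fx <-]|G ubG]; first exact/regular_principal_le.
  apply/moore_leP => x Fx; apply/regular_principal_le/ubG; exists x => //.
- move=> A; apply/esym/(@Meet_eq _ Reg); split=> [_ [x Ax <-]|G lbG].
    by apply/regular_principal_le/Join_ub.
  apply/moore_leP => y Gy; apply: Join_le => x Ax.
  by apply: (moore_leP G (moore_elt (princ_reg x))).1 Gy; apply: lbG; exists x.
- apply/eqP; rewrite (@eq_le _ Reg) le0x /= andbT.
  by apply/regular_principal_le; have [] := regular_filter \bot.
- move=> x y; pose p a : Reg := moore_elt (princ_reg a).
  apply: etrans (Join_pair (p x) (p y)); apply/esym/Join_eq.
  split=> [_ [->|->]|G ubG].
  + exact/regular_principal_le/leIl.
  + exact/regular_principal_le/leIr.
  apply/regular_principal_le; have [_ _ GI] := regular_filter G.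
  by apply: GI; apply/regular_principal_le; apply: ubG; [left|right].
- move=> A /strongly_exact_exact exA; apply/esym/(@Join_eq _ Reg).
  split=> [_ [x Ax <-]|G ubG]; first exact/regular_principal_le/Meet_lb.
  apply/regular_principal_le.
  have [_ Gex] := regular_exact (@moore_valP _ (regular_filters L) G).
  by apply: Gex => // x Ax; apply/regular_principal_le/ubG; exists x.
Qed.

Lemma regular_T1_raney : T1_raney_extension (principal_op princ_reg).
Proof.
split; first exact: regular_raney; split.
  exact: coframe_distr (raney_coframe regular_raney).
exact: regular_complement.
Qed.

End RegularFilters.

(** * Uniqueness of the T1 Raney extension *)

(** The isomorphism sends [c] to the set of the elements of [L] above it, and a
regular filter to its meet in [C]. The first is a polar: [x] is above [c]
if and only if its join with a complement of [c] is [\top], which is tested on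
the elements of [L] above that complement. The second loses no information: if
[x] is above the meet of [F], then [x `|` g = \top] for every [g] in the polar
of [F], since the meet of [F] already has this property. *)
Lemma T1_raney_unique d (L : frameType d) dC (C : completeLatticeType dC)
    (e : L -> C)
    (princ_reg : forall a : L, moore_sets (regular_filters L) (principal a)) :
  T1_raney_extension e -> raney_isomorphic e (principal_op princ_reg).
Proof.
move=> [Ce [_ compl]]; have coC := raney_coframe Ce.
have regC (c : C) : is_regular_filter [set x | c <= e x].
  have [c' [cc0 cc1]] := compl c.
  suff -> : [set x | c <= e x] = polar [set x | c' <= e x].
    exact: polar_regular.
  rewrite meetC in cc0; rewrite joinC in cc1.
  apply/seteqP; split=> x /=; rewrite (compl_le _ coC cc0 cc1).
    rewrite joinC -{1}(raney_Meet_above Ce c') => /eqP.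
    move=> /(raney_join_Meet_eq_top Ce) xc a /xc; rewrite -(raney_join Ce).
    by move/eqP; rewrite (raney_eq_top Ce) => /eqP.
  move=> xc; rewrite joinC -(raney_Meet_above Ce c'); apply/eqP.
  apply/(raney_join_Meet_eq_top Ce) => a /xc xa.
  by rewrite -(raney_join Ce) xa (raney_top Ce).
pose f (c : C) : (moore_type (regular_filters L))^d :=
  @moore_elt _ (regular_filters L) _ (regC c).
pose f' (F : (moore_type (regular_filters L))^d) : C :=
  Meet (e @` val (F : moore_type (regular_filters L))).
apply: (@raney_isomorphic_of_order_iso _ _ _ _ _ _ _ _ f f').
- by move=> b c bc; apply/(moore_leP (f c) (f b)) => x; apply: le_trans.
- move=> F G /(moore_leP G F) GF; apply: Meet_ge => _ [x Gx <-].
  by apply: Meet_lb; exists x => //; apply: GF.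
- exact: raney_Meet_above.
- move=> F; apply/val_inj/seteqP; split=> x /=; last first.
    by move=> Fx; apply: Meet_lb; exists x.
  move=> Fx; rewrite -regular_polarP => g Fg; apply/eqP.
  rewrite -(raney_eq_top Ce) (raney_join Ce) joinC eq_le lex1 /=.
  have <- : e g `|` f' F = \top.
    apply/(raney_join_Meet_eq_top Ce) => y Fy.
    by rewrite -(raney_join Ce) Fg // (raney_top Ce).
  exact: leU2.
- by move=> x; apply/val_inj/seteqP; split=> y /=; rewrite (raney_embedding Ce).
Qed.

Theorem theorem4p13 (d : Order.disp_t) (L : frameType d) :
  [<->
    subfit L;
    moore_sets (exact_filters L) `<=` moore_sets (regular_filters L);
    exists princM : forall a : L, moore_sets (exact_filters L) (principal a),
      T1_raney_extension (principal_op princM);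
    exists (dC : Order.disp_t) (C : completeLatticeType dC) (e : L -> C),
      T1_raney_extension e;
    exists princM : forall a : L, moore_sets (regular_filters L) (principal a),
      T1_raney_extension (principal_op princM) /\
      forall (dC : Order.disp_t) (C : completeLatticeType dC) (e : L -> C),
        T1_raney_extension e -> raney_isomorphic e (principal_op princM)].
Proof.
tfae.
- exact: subfit_exact_regular.
- move=> /exact_regular_filters exreg; exists (@principal_exact d L).
  move: (@principal_exact d L : forall a, moore_sets (exact_filters L) _).
  rewrite exreg; exact: regular_T1_raney.
- by move=> [princM T1]; do 3!eexists; exact: T1.
- move=> [dC [C [e /T1_raney_subfit/subfit_exact_regular sub]]].
  have princ_reg a : moore_sets (regular_filters L) (principal a).
    exact/sub/principal_exact.
  exists princ_reg; split=> [|dD D e']; first exact: regular_T1_raney.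
  exact: T1_raney_unique.
- by move=> [princ_reg [/T1_raney_subfit]].
Qed.
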